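(* Let $Z$ be a unique factorization domain. Let $n$ be any integer greater than $1$, and let $f(X)$ be an arbitrary polynomial in $Z[X]$ of positive degree $m$, leading coefficient $a$ and nonzero constant term $b$, that is irreducible in $Z[X]$. Assume that at least one of the conditions $\mathrm{C}(m,a,b,n)$, $\mathrm{C}(m,b,a,n)$ holds. Then $f(X^n)$ is irreducible in $Z[X]$.
   Context: $Z$ is an arbitrary unique factorization domain (a field is allowed) and $U$ is its group of units. For $t\in\mathbb N$ (positive integers), $Z^t=\{z^t : z\in Z\}$. For $a,b\in Z$ and $m,n\in\mathbb N$, $\mathrm{C}(m,a,b,n)$ denotes the following condition: for each prime number $p$ dividing $n$ and any unit $u\in U$, at least one of the following two statements (A), (B) is true: (A) $ua\notin Z^p$; (B) (i) $(-1)^m ub\notin Z^p$, and (ii) $ub\notin Z^2$ if $4\mid n$ (that is, (B) requires (i), and additionally requires $ub\notin Z^2$ when $4\mid n$). *)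

(* Defs.v *)
From mathcomp Require Import all_boot all_algebra.

Set Implicit Arguments.
Unset Strict Implicit.
Unset Printing Implicit Defensive.

Import GRing.Theory.
Local Open Scope ring_scope.

(* Irreducible element of a domain.  This is used both in Z and in {poly Z};
   over {poly Z} it differs from [irreducible_poly], which ignores constant
   factors (2 *: 'X is not irreducible in {poly int} in the present sense). *)
Definition irreducible_elt (D : idomainType) (x : D) : Prop :=
  [/\ x != 0, x \isn't a GRing.unit
    & forall y z : D, x = y * z ->
        y \is a GRing.unit \/ z \is a GRing.unit].

Definition associates (D : idomainType) (x y : D) : Prop :=
  exists2 u : D, u \is a GRing.unit & y = u * x.

(* In [ufd_uniqueness] the sequence t' is the reordering of t that matches s. *)
Record is_UFD (D : idomainType) : Prop := IsUFD {
  ufd_factorization : forall x : D, x != 0 -> x \isn't a GRing.unit ->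
    exists2 s : seq D,
      (forall y, y \in s -> irreducible_elt y) & x = \prod_(y <- s) y;
  ufd_uniqueness : forall s t : seq D,
    (forall y, y \in s -> irreducible_elt y) ->
    (forall y, y \in t -> irreducible_elt y) ->
    \prod_(y <- s) y = \prod_(y <- t) y ->
    exists t' : seq D,
      [/\ perm_eq t' t, size s = size t'
        & forall i, (i < size s)%N -> associates s`_i t'`_i]
}.

(* The membership x \in Z^t. *)
Definition is_power (D : idomainType) (t : nat) (x : D) : Prop :=
  exists z : D, x = z ^+ t.

Definition condC (D : idomainType) (m : nat) (a b : D) (n : nat) : Prop :=
  forall (p : nat) (u : D),
    prime p -> (p %| n)%N -> u \is a GRing.unit ->
    ~ is_power p (u * a) \/
    (~ is_power p ((-1) ^+ m * u * b) /\
     ((4 %| n)%N -> ~ is_power 2 (u * b))).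

(* Main.v *)
Require Import Defs.
From mathcomp Require Import all_boot all_algebra.
From mathcomp Require Import perm ring.

Set Implicit Arguments.
Unset Strict Implicit.
Unset Printing Implicit Defensive.

Import GRing.Theory.
Local Open Scope ring_scope.

(* Put X^p = Y and let N be the norm from Z[X] down to Z[Y].  If f(X^p) = g h
   then f^p = N(g) N(h) in Z[Y], where f is prime by Gauss's lemma, so
   N(g) = u f^j with u a unit, and 0 < j < p by degrees.  Comparing leading and
   constant coefficients, lc(g)^p = +-u a^j and g(0)^p = u b^j; as j is
   invertible modulo p, some unit v makes both v a and (-1)^m v b p-th powers.
   The theorem follows by introducing the prime factors of n one at a time.
   Passing from f(X^k) to f(X^(pk)), whose degrees are m k and m p k, the sign
   (-1)^(mk) is immaterial for odd p and equals (-1)^m for odd k; when p = 2 and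
   k is even, it is 1 and 4 | n. *)

Definition divides (D : idomainType) (x y : D) : Prop := exists z, y = z * x.

Definition prime_elt (D : idomainType) (q : D) : Prop :=
  [/\ q != 0, q \isn't a GRing.unit
    & forall x y, divides q (x * y) -> divides q x \/ divides q y].

(** * Prime elements and Gauss's lemma in a unique factorization domain *)

Lemma divides_mull (R : idomainType) (x y z : R) :
  divides x y -> divides x (z * y).
Proof. by move=> [w ->]; exists (z * w); rewrite mulrA. Qed.

Lemma divides0 (R : idomainType) (x : R) : divides x 0.
Proof. by exists 0; rewrite mul0r. Qed.

Lemma dividesD (R : idomainType) (x y z : R) :
  divides x y -> divides x z -> divides x (y + z).
Proof. by move=> [v ->] [w ->]; exists (v + w); rewrite mulrDl. Qed.

Lemma dividesB (R : idomainType) (x y z : R) :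
  divides x y -> divides x z -> divides x (y - z).
Proof. by move=> [v ->] [w ->]; exists (v - w); rewrite mulrBl. Qed.

Lemma size_polyMC (R : idomainType) (f : {poly R}) (c : R) :
  c != 0 -> size (f * c%:P) = size f.
Proof. by move=> c0; rewrite mulrC mul_polyC size_scale. Qed.

Section Divisibility.
Variable D : idomainType.

Lemma dvd_prod_mem (x : D) (s : seq D) :
  x \in s -> divides x (\prod_(y <- s) y).
Proof.
elim: s => // y s IH; rewrite inE big_cons => /orP[/eqP->|/IH[z ->]].
  by exists (\prod_(j <- s) j); rewrite mulrC.
by exists (y * z); rewrite mulrA.
Qed.

Lemma prime_elt_exp (q x : D) (n : nat) :
  prime_elt q -> divides q (x ^+ n) -> divides q x.
Proof.
move=> [_ nuq hq]; elim: n => [[z /esym zq]|n IH].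
  by case/negP: nuq; apply/unitrPr; exists z; rewrite mulrC.
by rewrite exprS => /hq [].
Qed.

Lemma prime_elt_pow_factor (q : D) (n : nat) (x y : D) :
  prime_elt q -> q ^+ n = x * y ->
  exists u j, u \is a GRing.unit /\ x = u * q ^+ j.
Proof.
move=> [q0 _ hq]; elim: n x y => [|n IH] x y.
  rewrite expr0 => /esym xy1; exists x, 0%N; rewrite mulr1; split=> //.
  by apply/unitrPr; exists y.
rewrite exprS => qE.
have /hq [[z zE]|[z zE]] : divides q (x * y).
- by exists (q ^+ n); rewrite -qE mulrC.
- have [|u [j [uu zE']]] := IH z y.
    by apply: (mulfI q0); rewrite qE zE; ring.
  by exists u, j.+1; rewrite zE zE' exprSr mulrA.
- by apply: (IH x z); apply: (mulfI q0); rewrite qE zE; ring.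
Qed.

Lemma polyC_divides (c : D) (f : {poly D}) :
  (forall i, divides c f`_i) -> divides c%:P f.
Proof.
elim/poly_ind: f => [_|f a IH h]; first by exists 0; rewrite mul0r.
have [|g ->] := IH.
  by move=> i; have := h i.+1; rewrite coefD coefMX coefC addr0.
have [e eE] := h 0%N; rewrite coefD coefMX coefC add0r in eE.
by exists (g * 'X + e%:P); rewrite eE polyCM; ring.
Qed.

Lemma polyC_divides_coef (c : D) (f : {poly D}) (i : nat) :
  divides c%:P f -> divides c f`_i.
Proof. by move=> [g ->]; exists g`_i; rewrite coefMC. Qed.

Lemma polyC_dividesMX (c : D) (f : {poly D}) :
  divides c%:P (f * 'X) -> divides c%:P f.
Proof.
move=> /polyC_divides_coef h; apply: polyC_divides => i.
by have := h i.+1; rewrite coefMX.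
Qed.

(** By double induction along constant terms: [q] divides [a * b], hence [a] or [b]. The term
    carrying that constant is subtracted from the product, and the remaining factor ['X] is
    cancelled. *)
Lemma prime_elt_polyC (q : D) (g h : {poly D}) : prime_elt q ->
  divides q%:P (g * h) -> divides q%:P g \/ divides q%:P h.
Proof.
move=> [_ _ hq].
elim/poly_ind: g h => [|g a IHg] h; first by left; apply: divides0.
elim/poly_ind: h => [|h b IHh] gh; first by right; apply: divides0.
have dvdC c : divides q c -> divides q%:P c%:P.
  by move=> [e ->]; exists e%:P; rewrite polyCM.
have /hq [/dvdC qa|/dvdC qb] : divides q (a * b).
- have := polyC_divides_coef 0 gh.
  by rewrite coefM big_ord1 !coefD !coefMX !coefC !add0r.
- have [|qg|qh] := IHg (h * 'X + b%:P); last by right.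
  + apply: polyC_dividesMX.
    have -> : g * (h * 'X + b%:P) * 'X
      = (g * 'X + a%:P) * (h * 'X + b%:P) - (h * 'X + b%:P) * a%:P by ring.
    by apply: dividesB => //; apply: divides_mull.
  + by left; apply: dividesD => //; rewrite mulrC; apply: divides_mull.
- have [|qg|qh] := IHh; first 1 last.
  + by left.
  + by right; apply: dividesD => //; rewrite mulrC; apply: divides_mull.
  + apply: polyC_dividesMX.
    have -> : (g * 'X + a%:P) * h * 'X
      = (g * 'X + a%:P) * (h * 'X + b%:P) - (g * 'X + a%:P) * b%:P by ring.
    by apply: dividesB => //; apply: divides_mull.
Qed.

(** Uniqueness of factorization compares bare products of irreducibles, so a stray unit has to be
    absorbed, here into the first factor. *)
Lemma unit_mul_prime_factorization (u : D) (s : seq D) :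
  u \is a GRing.unit -> s != [::] ->
  (forall y, y \in s -> irreducible_elt y) ->
  exists s', [/\ forall y, y \in s' -> irreducible_elt y,
    u * \prod_(y <- s) y = \prod_(y <- s') y
    & forall y, y \in s' -> exists2 x, x \in s & associates x y].
Proof.
move=> uu; case: s => // y s _ hs.
have [y0 nuy hy] : irreducible_elt y by apply: hs; rewrite mem_head.
exists (u * y :: s); split; last 1 first.
- move=> z; rewrite inE => /orP[/eqP->|zs].
    by exists y; [rewrite mem_head | exists u].
  by exists z; [rewrite inE zs orbT | exists 1; rewrite ?unitr1 ?mul1r].
- move=> z; rewrite inE => /orP[/eqP->|zs]; last first.
    by apply: hs; rewrite inE zs orbT.
  split; last 1 first.
  + move=> v w /(congr1 ( *%R u^-1)); rewrite mulKr // mulrA => /hy.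
    by rewrite unitrMr ?unitrV.
  + by rewrite mulf_neq0 //; apply: contraTneq uu => ->; rewrite unitr0.
  + by rewrite unitrMr.
- by rewrite !big_cons mulrA.
Qed.

Lemma size_poly_unit (f : {poly D}) : f \is a GRing.unit -> size f = 1%N.
Proof. by rewrite poly_unitE => /andP[/eqP]. Qed.

Lemma unit_polyC (c : D) : (c%:P \is a GRing.unit) = (c \is a GRing.unit).
Proof.
rewrite poly_unitE coefC eqxx size_polyC.
by case: (eqVneq c 0) => [->|]; rewrite ?unitr0.
Qed.

(** Primitivity: the cofactor of a nonunit constant would be a unit, hence constant, against the
    positive degree of [f]. *)
Lemma irreducible_poly_ndvdC (f : {poly D}) (q : D) :
  irreducible_elt f -> (1 < size f)%N -> q \isn't a GRing.unit ->
  ~ divides q%:P f.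
Proof.
move=> [f0 _ hf] sf nuq [g fE].
have [/size_poly_unit sg|] := hf _ _ fE; last by rewrite unit_polyC (negPf nuq).
have q0 : q != 0 by apply: contraNneq f0 => q0; rewrite fE q0 mulr0.
by move: sf; rewrite fE size_polyMC ?sg.
Qed.

End Divisibility.

Section UFD.
Variables (D : idomainType) (hD : is_UFD D).

Lemma ufd_prime_factorization (x : D) : x != 0 ->
  exists u s, [/\ u \is a GRing.unit, forall y, y \in s -> irreducible_elt y
    & x = u * \prod_(y <- s) y].
Proof.
move=> x0; have [ux|nux] := boolP (x \is a GRing.unit).
  by exists x, [::]; split; rewrite ?big_nil ?mulr1.
have [s hs ->] := ufd_factorization hD x0 nux.
by exists 1, s; rewrite mul1r unitr1.
Qed.

Lemma ufd_irreducible_prime (q : D) : irreducible_elt q -> prime_elt q.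
Proof.
move=> hq; have [q0 nuq _] := hq; split=> // x y [z xyE].
have [->|x0] := eqVneq x 0; first by left; exists 0; rewrite mul0r.
have [->|y0] := eqVneq y 0; first by right; exists 0; rewrite mul0r.
have z0 : z != 0.
  by apply: contraTneq (mulf_neq0 x0 y0) => z0; rewrite xyE z0 mul0r eqxx.
have [u [s [uu hs xE]]] := ufd_prime_factorization x0.
have [v [t [uv ht yE]]] := ufd_prime_factorization y0.
have [w [r [uw hr zE]]] := ufd_prime_factorization z0.
have stE : w^-1 * u * v * \prod_(i <- s ++ t) i = \prod_(i <- q :: r) i.
  apply: (can_inj (mulKr uw)).
  rewrite !mulrA divrr // mul1r big_cat big_cons /=.
  by transitivity (x * y); [rewrite xE yE; ring | rewrite xyE zE; ring].
have st0 : s ++ t != [::].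
  apply: contra nuq => /eqP st0; move: stE; rewrite st0 big_nil mulr1 big_cons.
  move/(congr1 (mem GRing.unit)) => /=.
  by rewrite !unitrM unitrV uu uv uw => /esym/andP[].
have [||L [hL LE Lst]] := @unit_mul_prime_factorization D (w^-1 * u * v) _ _ st0.
- by rewrite !unitrM unitrV uw uu uv.
- by move=> i; rewrite mem_cat => /orP[/hs|/ht].
rewrite {}LE in stE.
have hqr i : i \in q :: r -> irreducible_elt i.
  by rewrite inE => /orP[/eqP->|/hr].
have [L' [permL sz assL]] := ufd_uniqueness hD hqr hL (esym stE).
(* Index 0 of [q :: r] is [q] itself, so [q] is an associate of a factor of [x] or of [y]. *)
have [c uc cE] := assL 0%N isT; rewrite /= in cE.
have /Lst [k kst [e ue kE]] : L'`_0 \in L.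
  by rewrite -(perm_mem permL) mem_nth // -sz.
have qk : divides q k.
  by exists (e^-1 * c); rewrite -mulrA -cE kE mulKr.
move: kst; rewrite mem_cat xE yE => /orP[] /dvd_prod_mem [l ->].
  by left; do 2!apply: divides_mull.
by right; do 2!apply: divides_mull.
Qed.

Lemma ufd_ind (P : D -> Prop) :
  (forall u, u \is a GRing.unit -> P u) ->
  (forall q x, prime_elt q -> x != 0 -> P x -> P (q * x)) ->
  forall x, x != 0 -> P x.
Proof.
move=> Pu Pq x /ufd_prime_factorization [u [s [uu hs ->]]].
elim: s hs => [|q s IH] hs; first by rewrite big_nil mulr1; apply: Pu.
have hs' y : y \in s -> irreducible_elt y.
  by move=> ys; apply: hs; rewrite inE ys orbT.
rewrite big_cons mulrCA; apply: Pq; last exact: IH.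
  by apply/ufd_irreducible_prime/hs; rewrite mem_head.
rewrite mulf_neq0 //; first by apply: contraTneq uu => ->; rewrite unitr0.
by rewrite prodf_seq_neq0; apply/allP => y /hs' [y0 _ _]; rewrite y0.
Qed.

(** A form of integral closedness: a prime factor [q] of [x] divides [y], so [q ^+ p] cancels from
    both powers, and [x] loses its primes one by one. *)
Lemma ufd_exp_divides (x y : D) (p : nat) : (0 < p)%N -> x != 0 ->
  divides (x ^+ p) (y ^+ p) -> divides x y.
Proof.
case: p => // p _ x0; move: x x0 y.
apply: ufd_ind => [u uu y _|q x hq x0 IH y [z yE]].
  by exists (y / u); rewrite divrK.
have [|l yl] := @prime_elt_exp D q y p.+1 hq.
  by exists (z * x ^+ p.+1 * q ^+ p); rewrite yE exprMn [q ^+ p.+1]exprSr; ring.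
have [q0 _ _] := hq.
have /IH [l' lE] : divides (x ^+ p.+1) (l ^+ p.+1).
  exists z; apply: (mulIf (expf_neq0 p.+1 q0)).
  by rewrite -exprMn -yl yE exprMn; ring.
by exists l'; rewrite yl lE; ring.
Qed.

(** Denominators are cleared prime by prime: a prime factor of [c] divides [h * f] but not the
    primitive [f], so it can be removed from [h]. *)
Lemma divides_scale_cancel (f : {poly D}) (c : D) (g h : {poly D}) :
  irreducible_elt f -> (1 < size f)%N -> c != 0 ->
  c%:P * g = h * f -> divides f g.
Proof.
move=> hf sf c0; move: c c0 g h.
apply: ufd_ind => [u uu g h|q c hq c0 IH g h].
  rewrite -unit_polyC in uu; move/(canRL (mulKr uu)) ->.
  by exists ((u%:P)^-1 * h); rewrite mulrA.
have [q0 nuq _] := hq => gE.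
have [[k kE]|/irreducible_poly_ndvdC []//] : divides q%:P h \/ divides q%:P f.
  by apply: prime_elt_polyC hq _; exists (c%:P * g); rewrite -gE polyCM; ring.
apply: (IH g k); apply: (@mulfI _ q%:P); first by rewrite polyC_eq0.
by rewrite mulrA -polyCM gE kE; ring.
Qed.

(** This expresses irreducibility of [f] over the fraction field. Each prime factor of [c] divides
    [g] or [h], and removing it leaves degrees unchanged. *)
Lemma scale_irreducible_factor (f : {poly D}) (c : D) (g h : {poly D}) :
  irreducible_elt f -> (1 < size f)%N -> c != 0 ->
  c%:P * f = g * h -> size g = 1%N \/ size h = 1%N.
Proof.
move=> hf sf c0; move: c c0 g h.
apply: ufd_ind => [u uu g h|q c hq c0 IH g h].
  rewrite -unit_polyC in uu; move/(canRL (mulKr uu)); rewrite mulrA.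
  have [_ _ irrf] := hf.
  by case/irrf => [|/size_poly_unit]; rewrite ?unitrMr ?unitrV //;
    [move/size_poly_unit; left | right].
have [q0 nuq _] := hq => ghE.
have cancel_q k l : q%:P * (c%:P * f) = q%:P * (k * l) -> c%:P * f = k * l.
  by apply: mulfI; rewrite polyC_eq0.
have [[k kE]|[k kE]] : divides q%:P g \/ divides q%:P h.
- by apply: prime_elt_polyC hq _; exists (c%:P * f); rewrite -ghE polyCM; ring.
- rewrite kE size_polyMC //; apply: IH; apply: cancel_q.
  by rewrite mulrA -polyCM ghE kE; ring.
- rewrite kE size_polyMC //; apply: IH; apply: cancel_q.
  by rewrite mulrA -polyCM ghE kE; ring.
Qed.

(* Gauss's lemma, with pseudo-division in D[X] replacing the fraction field. *)
Lemma ufd_irreducible_poly_prime (f : {poly D}) :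
  irreducible_elt f -> (1 < size f)%N -> prime_elt f.
Proof.
move=> hf sf; have [f0 nuf _] := hf; split=> // g h [k ghE].
have /Pdiv.WeakIdomain.dvdpP [[c l] /= c0 fE] := dvdp_gcdl f g.
rewrite -mul_polyC in fE.
(* Either the cofactor [l] is constant and the gcd is [f] up to constants, or the gcd is constant
   and [f] is coprime to [g]. *)
case: (scale_irreducible_factor hf sf c0 fE) => [/eqP/size_poly1P [e e0 lE]|sd].
  left; have /Pdiv.WeakIdomain.dvdpP [[c' l'] /= c'0 gE] := dvdp_gcdr f g.
  rewrite -mul_polyC in gE.
  apply: (@divides_scale_cancel f (e * c') g (l' * c%:P)) => //.
    by rewrite mulf_neq0.
  by rewrite polyCM -mulrA gE -mulrA fE lE; ring.
right; have /Pdiv.WeakIdomain.dvdpP [[e r] /= e0 hE] : f %| h.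
  rewrite -(@Gauss_dvdpr _ h g f) ?/coprimep ?sd //.
  apply/Pdiv.WeakIdomain.dvdpP.
  by exists (1, k); rewrite ?oner_eq0 ?scale1r.
by rewrite -mul_polyC in hE; apply: divides_scale_cancel hE.
Qed.
End UFD.

(** * The norm from R[X] to R[X^(p+1)] *)

Section Coef.
Variable R : comNzRingType.

Lemma coefM_top (f g : {poly R}) (k l : nat) :
  (size f <= k.+1)%N -> (size g <= l.+1)%N -> (f * g)`_(k + l) = f`_k * g`_l.
Proof.
move=> sf sg; rewrite coefM.
have lt_k : (k < (k + l).+1)%N by rewrite ltnS leq_addr.
rewrite (bigD1 (Ordinal lt_k)) //= addKn big1 ?addr0 // => i neq_ik.
have [lt_ik|le_ki] := ltnP i k.
  rewrite [g`_ _]nth_default ?mulr0 //; apply: leq_trans sg _.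
  by rewrite ltn_subRL ltn_add2r.
rewrite [f`_ _]nth_default ?mul0r //; apply: leq_trans sf _.
by rewrite ltn_neqAle le_ki andbT eq_sym.
Qed.

Lemma coef_prod_top (n k : nat) (F : 'I_n -> {poly R}) :
  (forall i, (size (F i) <= k.+1)%N) ->
  (size (\prod_i F i)%R <= (n * k).+1)%N
    /\ (\prod_i F i)`_(n * k) = \prod_i (F i)`_k.
Proof.
elim: n F => [|n IH] F sF; first by rewrite !big_ord0 size_poly1 coef1.
have [sP cP] := IH (fun i => F (lift ord0 i)) (fun i => sF _).
rewrite !big_ord_recl mulSn coefM_top // cP; split=> //.
apply: leq_trans (size_polyMleq _ _) _.
by rewrite -subn1 leq_subLR add1n -addSn -addnS leq_add.
Qed.

(** Every Leibniz term is a signed product of [n] entries, so its coefficient of degree [n * k] only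
    involves the entries' coefficients of degree [k]. *)
Lemma coef_det_top (n k : nat) (A : 'M[{poly R}]_n) :
  (forall i j, (size (A i j) <= k.+1)%N) ->
  (size (\det A) <= (n * k).+1)%N
    /\ (\det A)`_(n * k) = \det (map_mx (coefp k) A).
Proof.
move=> sA; split.
  apply: (leq_trans (size_sum _ _ _)); apply/bigmax_leqP => s _.
  rewrite -signr_odd mulr_sign; case: (odd _); rewrite ?size_polyN.
    by have [] := @coef_prod_top n k (fun i => A i (s i)).
  by have [] := @coef_prod_top n k (fun i => A i (s i)).
rewrite coef_sum; apply: eq_bigr => s _.
have [_ cP] := @coef_prod_top n k (fun i => A i (s i)) (fun i => sA _ _).
rewrite -signr_odd -[(-1) ^+ _ in RHS]signr_odd !mulr_sign.
case: (odd _); rewrite ?coefN cP; last by apply: eq_bigr => i _; rewrite mxE.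
by congr (- _); apply: eq_bigr => i _; rewrite mxE.
Qed.
End Coef.

Section TwistedShift.
Variables (R : comNzRingType) (p : nat).

(* The matrix of multiplication by [X] on [R[X]/(X^(p+1) - y)]. *)
Definition twisted_shift (y : R) : 'M[R]_p.+1 :=
  \matrix_(i, j) if i == ord_max then (if j == ord0 then y else 0)
                 else (i.+1 == j)%:R.

Lemma row_twisted_shift_max (y : R) :
  row ord_max (twisted_shift y) = y *: delta_mx 0 ord0.
Proof.
apply/rowP => j; rewrite !mxE !eqxx /=.
by case: (j == ord0); rewrite ?mulr1 ?mulr0.
Qed.

Lemma row_twisted_shift_lt (y : R) (i : 'I_p.+1) (lt_ip : (i.+1 < p.+1)%N) :
  row i (twisted_shift y) = delta_mx 0 (Ordinal lt_ip).
Proof.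
have /negPf neq_im : i != ord_max by rewrite -val_eqE /= neq_ltn -ltnS lt_ip.
by apply/rowP => j; rewrite !mxE eqxx neq_im eq_sym.
Qed.

(** The first basis vector is cyclic for the shift; powers below [p.+1] move it without using the
    last row, the only one containing [y]. *)
Lemma row_twisted_shift_exp (y : R) (i : 'I_p.+1) :
  row ord0 (twisted_shift y ^+ i) = delta_mx 0 i.
Proof.
case: i => i /=; elim: i => [|i IH] lt_ip.
  by rewrite expr0 row1; congr (delta_mx _ _); apply/val_inj.
have lt_ip' : (i < p.+1)%N by apply: ltn_trans lt_ip.
rewrite exprSr row_mul IH -rowE.
by rewrite (row_twisted_shift_lt _ (i := Ordinal lt_ip')).
Qed.

(** Both sides agree on the first basis vector, and they commute with the powers of the shift that
    produce the other basis vectors from it. *)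
Lemma twisted_shift_exp (y : R) : twisted_shift y ^+ p.+1 = y%:M.
Proof.
have row0 : row ord0 (twisted_shift y ^+ p.+1) = y *: delta_mx 0 ord0.
  rewrite exprSr row_mul (row_twisted_shift_exp y ord_max) -rowE.
  exact: row_twisted_shift_max.
apply/row_matrixP => i.
rewrite rowE -(row_twisted_shift_exp y) -row_mul.
rewrite -[X in row _ X]/(twisted_shift y ^+ i * twisted_shift y ^+ p.+1).
rewrite -exprD addnC exprD [LHS]row_mul row0 -scalemxAl -rowE.
by rewrite row_twisted_shift_exp [in RHS]rowE mul_mx_scalar.
Qed.

Lemma det_twisted_shift (y : R) : \det (twisted_shift y) = (-1) ^+ p * y.
Proof.
rewrite (expand_det_row _ ord_max) (bigD1 ord0) //= big1 ?addr0; last first.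
  by move=> j /negPf j0; rewrite mxE eqxx j0 mul0r.
rewrite mxE !eqxx /cofactor addn0 mulrC; congr (_ * _).
rewrite (_ : row' _ _ = 1%:M) ?det1 ?mulr1 //.
apply/matrixP => i j; rewrite !mxE eq_sym (negPf (neq_lift _ _)).
by rewrite lift_max lift0 eqSS.
Qed.
End TwistedShift.

Section PolyNorm.
Variables (R : idomainType) (p : nat).

(* The norm of [g(X)] from [R[X]] down to [R[X^(p+1)]]. *)
Definition poly_norm (g : {poly R}) : {poly R} :=
  \det (horner_mx (twisted_shift p 'X) (map_poly polyC g)).

Lemma poly_normM (g h : {poly R}) :
  poly_norm (g * h) = poly_norm g * poly_norm h.
Proof. by rewrite /poly_norm !rmorphM /= [in LHS]det_mulmx. Qed.

(** The shift has [p.+1]-st power ['X], so [f \Po 'X^(p.+1)] acts as the scalar [f]; the variable of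
    the norm stands for ['X^(p.+1)]. *)
Lemma poly_norm_comp_Xn (f : {poly R}) :
  poly_norm (f \Po 'X^(p.+1)) = f ^+ p.+1.
Proof.
rewrite /poly_norm (_ : horner_mx _ _ = f%:M) ?det_scalar //.
elim/poly_ind: f => [|f c IH]; first by rewrite comp_poly0 !rmorph0.
rewrite comp_poly_MXaddC !rmorphD !rmorphM /= IH map_polyXn map_polyC /=.
rewrite rmorphXn /= horner_mx_X horner_mx_C twisted_shift_exp.
by rewrite -[_%:M * _]scalar_mxM.
Qed.

(** Conjugation is phrased without an inverse because the diagonal matrix used below need not be
    invertible over a polynomial ring. *)
Lemma horner_mx_intertwine (S : comNzRingType) (n : nat) (Q A B : 'M[S]_n.+1)
    (g : {poly S}) :
  Q * A = B * Q -> Q * horner_mx A g = horner_mx B g * Q.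
Proof.
move=> QA; elim/poly_ind: g => [|g c IH]; first by rewrite !rmorph0 mulr0 mul0r.
rewrite !rmorphD !rmorphM /= !horner_mx_X !horner_mx_C mulrDr mulrDl.
rewrite mulrA IH -[in RHS]mulrA -QA mulrA.
by congr (_ + _); apply: scalar_mxC.
Qed.

(* Over [R[T]], conjugating by [diag(T^p, ..., T, 1)] turns the shift twisted by
   [T^(p+1)] into [T] times the cyclic permutation matrix. *)
Lemma twisted_shift_conj :
  let Q : 'M[{poly R}]_p.+1 := diag_mx (\row_i 'X^(p - i)) in
  Q *m twisted_shift p 'X^(p.+1)
  = ('X *: map_mx polyC (twisted_shift p 1)) *m Q.
Proof.
apply/matrixP => i j.
rewrite mul_diag_mx mul_mx_diag !mxE.
have [->|neq_ip] := eqVneq i ord_max.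
  rewrite subnn mul1r.
  have [->|_] := eqVneq j ord0; last by rewrite !(mulr0, mul0r).
  by rewrite subn0 mulr1 exprS.
have lt_ip : (i < p)%N.
  by rewrite ltn_neqAle -ltnS ltn_ord andbT -val_eqE in neq_ip *.
have [ij|_] := eqVneq i.+1 (j : nat); last by rewrite !(mulr0, mul0r).
by rewrite !mulr1 -exprS -ij subnSK.
Qed.

(** The right side plays the role of the product of the g(zT) over the (p+1)-st roots of unity z,
    with a cyclic permutation matrix instead of adjoined roots. *)
Lemma poly_norm_comp (g : {poly R}) :
  poly_norm g \Po 'X^(p.+1) =
  \det (horner_mx ('X *: map_mx polyC (twisted_shift p 1)) (map_poly polyC g)).
Proof.
rewrite /poly_norm.
rewrite -det_map_mx map_horner_mx.
rewrite (_ : map_poly _ _ = map_poly polyC g); last first.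
  by rewrite -map_poly_comp; apply: eq_map_poly => c /=; rewrite comp_polyC.
rewrite (_ : map_mx _ _ = twisted_shift p 'X^(p.+1)); last first.
  apply/matrixP => i j; rewrite !mxE.
  by do !case: ifP => _; rewrite ?rmorph0 ?rmorph_nat /= ?comp_polyX.
have /(horner_mx_intertwine (map_poly polyC g)) := twisted_shift_conj.
(* The determinant of the diagonal matrix is a product of powers of ['X], hence nonzero and
   cancellable. *)
move/(congr1 (@determinant _ _)); rewrite /= !det_mulmx mulrC; apply: mulIf.
rewrite det_diag prodf_seq_neq0; apply/allP => i _.
by rewrite mxE expf_neq0 ?polyX_eq0.
Qed.

Lemma horner_mx_scaleX_entry (A : 'M[R]_p.+1) (g : {poly R}) (i j : 'I_p.+1) :
  horner_mx ('X *: map_mx polyC A) (map_poly polyC g) i j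
  = \poly_(l < size g) (g`_l * (A ^+ l) i j).
Proof.
rewrite -[g in LHS]coefK poly_def poly_def !rmorph_sum /= summxE.
apply: eq_bigr => l _; rewrite -mul_polyC !rmorphM /= map_polyC map_polyXn /=.
rewrite horner_mx_C rmorphXn /= horner_mx_X exprZn -rmorphXn /=.
by rewrite [_ * _]mul_scalar_mx !mxE -mul_polyC polyCM mulrCA mulrC.
Qed.

(** At T = 0 the matrix g(TP), with P the cyclic permutation matrix, reduces to the scalar matrix of
    the constant term of [g]. *)
Lemma coef0_poly_norm (g : {poly R}) : (poly_norm g)`_0 = g`_0 ^+ p.+1.
Proof.
have <- : (poly_norm g \Po 'X^(p.+1))`_0 = (poly_norm g)`_0.
  by rewrite coef_comp_poly_Xn // dvdn0 div0n.
rewrite poly_norm_comp -horner_coef0 -[_.[0]]/(horner_eval 0 _) -det_map_mx.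
rewrite -det_scalar; congr (\det _); apply/matrixP => i j.
rewrite [LHS]mxE horner_mx_scaleX_entry /= /horner_eval horner_coef0 coef_poly.
rewrite expr0 !mxE mulr_natr; case: (posnP (size g)) => // /eqP.
by rewrite size_poly_eq0 => /eqP ->; rewrite coef0 mul0rn.
Qed.

(** The entries of g(TP) have degree at most [k], and their coefficients of degree [k] form the
    matrix [lead_coef g] times P^k, where P has determinant (-1)^p. *)
Lemma coef_top_poly_norm (g : {poly R}) (k : nat) : size g = k.+1 ->
  (size (poly_norm g \Po 'X^(p.+1)) <= (p.+1 * k).+1)%N /\
  (poly_norm g \Po 'X^(p.+1))`_(p.+1 * k)
  = (-1) ^+ (p * k) * lead_coef g ^+ p.+1.
Proof.
move=> sg; rewrite poly_norm_comp.
set M := horner_mx _ _.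
have sM i j : (size (M i j) <= k.+1)%N.
  by rewrite /M horner_mx_scaleX_entry sg size_poly.
have [-> ->] := coef_det_top sM; split=> //.
have -> : map_mx (coefp k) M = lead_coef g *: twisted_shift p 1 ^+ k.
  apply/matrixP => i j; rewrite !mxE /M horner_mx_scaleX_entry /=.
  by rewrite coef_poly sg ltnSn lead_coefE sg.
rewrite detZ mulrC exprM; congr (_ * _).
elim: (k) => [|l IH]; first by rewrite !expr0 det1.
by rewrite exprS [LHS]det_mulmx IH det_twisted_shift mulr1 exprS.
Qed.
End PolyNorm.

(** * Substituting powers of X *)

Section XnSubstitution.
Variables (D : idomainType) (hD : is_UFD D).

(** Raising to the power [r] turns [a ^+ j] into [a * (a ^+ s) ^+ p]; the [p]-th power
    [(a ^+ s) ^+ p] is then divided out inside [D]. *)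
Lemma power_of_power_associate (p j r s : nat) (u a c : D) :
  (0 < p)%N -> a != 0 -> (r * j = (s * p).+1)%N -> c ^+ p = u * a ^+ j ->
  is_power p (u ^+ r * a).
Proof.
move=> p0 a0 rjE cE.
have crE : (c ^+ r) ^+ p = u ^+ r * a * (a ^+ s) ^+ p.
  rewrite -exprM mulnC exprM cE exprMn -[(a ^+ j) ^+ r]exprM.
  by rewrite [(j * r)%N]mulnC rjE exprS exprM mulrA.
have [|z zE] := @ufd_exp_divides _ hD (a ^+ s) (c ^+ r) p p0 (expf_neq0 s a0).
  by exists (u ^+ r * a).
exists z; apply: (mulIf (expf_neq0 p (expf_neq0 s a0))).
by rewrite -crE zE exprMn.
Qed.

Lemma comp_Xn_factor_powers (p M : nat) (f g h : {poly D}) :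
  prime p -> irreducible_elt f -> size f = M.+1 -> (0 < M)%N -> f`_0 != 0 ->
  f \Po 'X^p = g * h -> (1 < size g)%N -> (1 < size h)%N ->
  exists v, [/\ v \is a GRing.unit, is_power p (v * lead_coef f)
    & is_power p ((-1) ^+ M * v * f`_0)].
Proof.
move=> pp hf sf M0 b0 fE sg sh.
have sf1 : (1 < size f)%N by rewrite sf.
have [f0 _ _] := hf.
have fprime := ufd_irreducible_poly_prime hD hf sf1.
(* From here the prime is [q], and [p] is its predecessor, as the norm expects. *)
case: p pp fE => // p pp fE; set q := p.+1 in pp fE *.
have NE : f ^+ q = poly_norm p g * poly_norm p h.
  by rewrite -poly_normM -fE poly_norm_comp_Xn.
have [U [j [uU gE]]] := prime_elt_pow_factor fprime NE.
have /eqP/size_poly1P [u u0 UE] := size_poly_unit uU.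
have uu : u \is a GRing.unit by rewrite -unit_polyC -UE.
have [k sgE] : exists k, size g = k.+1 by case: (size g) sg => // k _; exists k.
have k0 : (0 < k)%N by rewrite sgE in sg.
have g0 : g != 0 by rewrite -size_poly_eq0 sgE.
have [sN cN] := coef_top_poly_norm p sgE.
rewrite gE UE mul_polyC comp_polyZ in sN cN.
have sfj : size (f ^+ j \Po 'X^q) = (M * j * q).+1.
  rewrite -[LHS]prednK ?size_comp_poly ?size_polyXn ?size_exp ?sf //=.
  by rewrite lt0n size_poly_eq0 comp_poly_eq0 ?size_polyXn // expf_neq0.
(* The size bound [sN] gives one inequality; the other holds because the coefficient in [cN] is
   nonzero. *)
have MjE : (M * j = k)%N.
  apply/eqP; rewrite -(eqn_pmul2r (ltn0Sn p)) eqn_leq -/q.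
  rewrite size_scale // sfj ltnS in sN; rewrite [(k * q)%N]mulnC sN /=.
  have : (u *: (f ^+ j \Po 'X^q))`_(q * k) != 0.
    by rewrite cN mulf_neq0 ?signr_eq0 // expf_neq0 // lead_coef_eq0.
  rewrite coefZ mulf_eq0 negb_or => /andP[_]; apply: contraR.
  rewrite -ltnNge => lt.
  by rewrite nth_default ?sfj.
have lcE : (-1) ^+ (p * k) * lead_coef g ^+ q = u * lead_coef f ^+ j.
  rewrite -cN coefZ -lead_coef_exp; congr (_ * _).
  have -> : (q * k = M * j * q)%N by rewrite MjE mulnC.
  by rewrite coef_comp_poly_Xn // dvdn_mull // mulnK // lead_coefE size_exp sf.
have b0E : g`_0 ^+ q = u * f`_0 ^+ j.
  by rewrite -coef0_poly_norm gE UE coefCM -!horner_coef0 horner_exp.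
have j0 : (0 < j)%N by move: k0; rewrite -MjE muln_gt0 => /andP[].
(* Since [h] has positive degree, the degree [k = M * j] of [g] is less than [M * q]. *)
have lt_jq : (j < q)%N.
  have h0 : h != 0 by rewrite -size_poly_gt0 ltnW.
  have := congr1 (fun P : {poly D} => (size P).-1) fE.
  rewrite size_comp_poly size_polyXn size_mul // sf sgE /= => MqE.
  rewrite -(ltn_pmul2l M0) MqE MjE; case: (size h) sh => [|[|l]] // _.
  by rewrite !addnS ?addSn /= ltnS leq_addr.
have cop : coprime j q by rewrite coprime_sym prime_coprime // gtnNdvd.
case: (egcdnP q j0) => r s rsE _; rewrite (eqP cop) addn1 in rsE.
pose e : D := (-1) ^+ (p * k).
have e2 : e * e = 1 by rewrite /e -expr2 sqrr_sign.
have ue : e \is a GRing.unit by rewrite unitrX ?unitrN1.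
(* The sign [e] is moved to the unit in [lcE], and [r] is the inverse of [j] modulo [q]. *)
exists ((e * u) ^+ r); split; first by rewrite unitrX // unitrM ue.
  apply: (@power_of_power_associate q j r s _ _ (lead_coef g)) => //.
    by rewrite lead_coef_eq0.
  by rewrite -mulrA -lcE mulrA e2 mul1r.
have [z zE] := power_of_power_associate (ltn0Sn p) b0 rsE b0E.
have -> : (-1) ^+ M * (e * u) ^+ r * f`_0 = (-1) ^+ M * e ^+ r * z ^+ q.
  by rewrite exprMn -zE; ring.
(* For odd [q] every sign is its own [q]-th power. For [q = 2] the exponent is [M + M * j * r] with
   [r * j] odd, so the sign is 1. *)
have [eps ->] : is_power q ((-1) ^+ M * e ^+ r).
  rewrite /e -exprM -exprD; case: (even_prime pp) => [q2|oddq].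
    have p1 : p = 1%N by case: q2.
    exists 1; rewrite expr1n p1 mul1n -MjE -signr_odd oddD !oddM.
    have : odd (r * j) by rewrite rsE q2 /= oddM andbF.
    by rewrite oddM => /andP[-> ->]; rewrite !andbT addbb.
  exists ((-1) ^+ (M + p * k * r)); rewrite -exprM -[RHS]signr_odd.
  by rewrite oddM oddq andbT signr_odd.
by exists (eps * z); rewrite exprMn.
Qed.

(** The coefficients of [f] all occur in [f \Po 'X^n], so a constant factor divides the primitive
    polynomial [f]. *)
Lemma comp_Xn_const_factor (n : nat) (f g h : {poly D}) :
  (0 < n)%N -> irreducible_elt f -> (1 < size f)%N -> f \Po 'X^n = g * h ->
  size g = 1%N -> g \is a GRing.unit.
Proof.
move=> n0 hf sf fE /eqP/size_poly1P [c c0 gE]; rewrite gE unit_polyC.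
apply/negPn/negP => /(irreducible_poly_ndvdC hf sf); apply.
apply: polyC_divides => i.
have := @polyC_divides_coef _ c (f \Po 'X^n) (i * n).
rewrite coef_comp_poly_Xn // dvdn_mull // mulnK //; apply.
by exists h; rewrite fE gE mulrC.
Qed.

Lemma irreducible_comp_Xp (p M : nat) (f : {poly D}) :
  prime p -> irreducible_elt f -> size f = M.+1 -> (0 < M)%N -> f`_0 != 0 ->
  (forall v, v \is a GRing.unit -> is_power p (v * lead_coef f) ->
     ~ is_power p ((-1) ^+ M * v * f`_0)) ->
  irreducible_elt (f \Po 'X^p).
Proof.
move=> pp hf sf M0 b0 hp; have [f0 _ _] := hf.
have p0 := prime_gt0 pp.
have sf1 : (1 < size f)%N by rewrite sf.
have fp0 : f \Po 'X^p != 0 by rewrite comp_poly_eq0 // size_polyXn.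
split=> // [|g h fE].
  apply/negP => /size_poly_unit /(congr1 predn).
  rewrite size_comp_poly size_polyXn sf /= => /eqP.
  by rewrite muln_eq0 -!leqn0 leqNgt M0 leqNgt p0.
move: fp0; rewrite fE mulf_eq0 negb_or -!size_poly_gt0 => /andP[g0 h0].
have [sg|sg] := leqP (size g) 1.
  by left; apply: comp_Xn_const_factor fE _ => //; apply/anti_leq; rewrite sg.
have [sh|sh] := leqP (size h) 1.
  right; rewrite mulrC in fE.
  by apply: comp_Xn_const_factor fE _ => //; apply/anti_leq; rewrite sh.
have [v [uv hv1 hv2]] := comp_Xn_factor_powers pp hf sf M0 b0 fE sg sh.
by case: (hp v).
Qed.
End XnSubstitution.

(** * The condition C and the induction over the divisors of n *)

Lemma signed_power_cases (D : idomainType) (m n p k : nat) (x : D) :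
  prime p -> (p * k %| n)%N -> is_power p ((-1) ^+ (m * k) * x) ->
  is_power p ((-1) ^+ m * x) \/ (4 %| n)%N /\ is_power 2 x.
Proof.
move=> pp pkn [z zE]; case: (even_prime pp) => [p2|oddp].
  subst p; have [oddk|evenk] := boolP (odd k).
    by left; exists z; rewrite -zE -[in RHS]signr_odd oddM oddk andbT signr_odd.
  right; split; last first.
    by exists z; rewrite -zE -signr_odd oddM (negPf evenk) andbF mul1r.
  by apply: dvdn_trans pkn; rewrite (@dvdn_pmul2l 2 2) // dvdn2.
(* For odd [p] this sign equals its [p]-th power and changes [(-1) ^+ (m * k)] into [(-1) ^+ m]. *)
left; exists ((-1) ^+ (m + m * k) * z); rewrite exprMn -zE -exprM.
rewrite -[(-1) ^+ (_ * p)]signr_odd oddM oddp andbT signr_odd mulrA.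
rewrite -exprD -addnA addnn -[in RHS]signr_odd oddD odd_double addbF.
by rewrite signr_odd.
Qed.

Lemma condC_not_powers (D : idomainType) (m n p k : nat) (a b v : D) :
  condC m a b n -> prime p -> (p * k %| n)%N -> v \is a GRing.unit ->
  is_power p (v * a) -> ~ is_power p ((-1) ^+ (m * k) * v * b).
Proof.
move=> hC pp pkn uv hva; rewrite -mulrA.
have pn : (p %| n)%N := dvdn_trans (dvdn_mulr k (dvdnn p)) pkn.
case: (hC p v pp pn uv) => [//|[nvb nvb4]].
move/(signed_power_cases pp pkn) => [|[n4 /(nvb4 n4)//]].
by rewrite mulrA.
Qed.

Theorem theorem1p1 (Z : idomainType) (hZ : is_UFD Z) (n : nat) (hn : (1 < n)%N)
    (f : {poly Z}) (m : nat) (a b : Z)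
    (hm : (0 < m)%N) (hdeg : size f = m.+1)
    (ha : lead_coef f = a) (hb : f`_0 = b) (hb0 : b != 0)
    (hf : irreducible_elt f)
    (hC : condC m a b n \/ condC m b a n) :
  irreducible_elt (f \Po 'X^n).
Proof.
have n0 : (0 < n)%N := ltnW hn.
(* Ranging over all divisors [k] of [n] allows strong induction while the condition is kept for the
   fixed [n]. *)
suff irr_dvd k : (k %| n)%N -> irreducible_elt (f \Po 'X^k) by apply: irr_dvd.
elim/ltn_ind: k => k IH kn; have k0 := dvdn_gt0 n0 kn.
have [k1|k1] := leqP k 1.
  have -> : k = 1%N by apply/anti_leq; rewrite k1.
  by rewrite expr1 comp_polyXr.
have pp := pdiv_prime k1; set p := pdiv k in pp.
have p0 := prime_gt0 pp; have pn0 : p != 0%N by rewrite -lt0n.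
have [l kE] : exists l, k = (p * l)%N.
  by have /dvdnP [l ->] := pdiv_dvd k; exists l; rewrite mulnC.
have l0 : (0 < l)%N by move: k0; rewrite kE muln_gt0 => /andP[].
rewrite {}kE in kn IH *.
have ln : (l %| n)%N := dvdn_trans (dvdn_mull p (dvdnn l)) kn.
have irrl : irreducible_elt (f \Po 'X^l).
  by apply: IH => //; rewrite ltn_Pmull // prime_gt1.
have -> : f \Po 'X^(p * l) = (f \Po 'X^l) \Po 'X^p.
  by rewrite -comp_polyA comp_Xn_poly exprM.
have sfl : size (f \Po 'X^l) = (m * l).+1.
  rewrite -[LHS]prednK ?size_comp_poly ?size_polyXn ?hdeg //.
  by have [fl0 _ _] := irrl; rewrite size_poly_gt0.
have coef0 : (f \Po 'X^l)`_0 = b by rewrite coef_comp_poly_Xn // dvdn0 div0n.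
have lc : lead_coef (f \Po 'X^l) = a.
  rewrite lead_coefE sfl coef_comp_poly_Xn // dvdn_mull // mulnK //.
  by rewrite -ha lead_coefE hdeg.
apply: (irreducible_comp_Xp hZ pp irrl sfl);
  rewrite ?muln_gt0 ?hm ?coef0 ?lc //.
move=> v uv hva hvb.
case: hC => hC; first exact: condC_not_powers hC pp kn uv hva hvb.
(* With [a] and [b] exchanged, this unit takes the place of [v]: the sign moves from [b] to [a],
   where it is squared away. *)
have uw : (-1) ^+ (m * l) * v \is a GRing.unit.
  by rewrite unitrM unitrX ?unitrN1.
apply: (condC_not_powers hC pp kn uw hvb).
by rewrite !mulrA -expr2 sqrr_sign mul1r.
Qed.
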